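(* Let $F$ be a field of characteristic $\neq 2$, let $\mathfrak g$ be a Lie algebra over $F$ endowed with a group homomorphism $A_4\to \mathrm{Aut}(\mathfrak g)$, and let $A=\mathfrak g_0$, the multiplication $*$ on $A$, and the maps $\delta_0,\delta_1,\delta_2:A\times A\to\mathfrak{gl}(A)$ be as defined in the context. Then for any $a,b,x,y,z\in A$ and $i,j\in\mathbb Z_3$: (i) $[\delta_i(a,b),\delta_j(x,y)]=\delta_j\bigl(\delta_{i-j}(a,b)(x),y\bigr)+\delta_j\bigl(x,\delta_{i-j}(a,b)(y)\bigr)$; (ii) $\delta_0(x,y*z)+\delta_{-1}(y,z*x)+\delta_{-2}(z,x*y)=0$; (iii) $\delta_0(x,y)(z)+\delta_0(y,z)(x)+\delta_0(z,x)(y)=0$; (iv) $\delta_1(x,y)=r_yl_x-r_xl_y$; (v) $\delta_2(x,y)=l_yr_x-l_xr_y$, where $l_x:z\mapsto x*z$ and $r_x:z\mapsto z*x$.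
   Context: $A_4$ is the alternating group of degree $4$. Put $\tau_1=(12)(34)$, $\tau_2=(23)(14)$, $\varphi=(123)$ (i.e. $1\mapsto2\mapsto3\mapsto1$), with permutations composed right to left, so that $\tau_1\tau_2=\tau_2\tau_1$, $\varphi\tau_1=\tau_2\varphi$, $\varphi\tau_2=\tau_1\tau_2\varphi$. The images of these elements in $\mathrm{Aut}(\mathfrak g)$ are denoted by the same symbols. Define $\mathfrak t=\{x\in\mathfrak g:\tau_1(x)=x,\ \tau_2(x)=x\}$, $\mathfrak g_0=\{x:\tau_1(x)=x,\ \tau_2(x)=-x\}$, $\mathfrak g_1=\{x:\tau_1(x)=-x,\ \tau_2(x)=x\}$, $\mathfrak g_2=\{x:\tau_1(x)=-x,\ \tau_2(x)=-x\}$, with indices $0,1,2$ regarded as elements of $\mathbb Z_3$. Then $\mathfrak g=\mathfrak t\oplus\mathfrak g_0\oplus\mathfrak g_1\oplus\mathfrak g_2$ is a $\mathbb Z_2\times\mathbb Z_2$-grading, $\varphi(\mathfrak t)=\mathfrak t$ and $\varphi(\mathfrak g_i)=\mathfrak g_{i+1}$. Put $A=\mathfrak g_0$ and, for $x\in A$, $\iota_0(x)=x$, $\iota_1(x)=\varphi(x)\in\mathfrak g_1$, $\iota_2(x)=\varphi^2(x)\in\mathfrak g_2$. The bilinear multiplication $*$ on $A$ is defined by $[\iota_1(x),\iota_2(y)]=\iota_0(x*y)$ (equivalently, $[\iota_i(x),\iota_{i+1}(y)]=\iota_{i+2}(x*y)$ for all $i\in\mathbb Z_3$). For $i\in\mathbb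 Z_3$ define $\rho_i:\mathfrak t\to\mathfrak{gl}(A)$ by $\iota_i(\rho_i(d)(x))=[d,\iota_i(x)]$ for $d\in\mathfrak t$, $x\in A$. Here $\mathfrak{gl}(A)$ is the Lie algebra of all linear endomorphisms of $A$. For $x,y\in A$ put $\delta_i(x,y)=\rho_i([\iota_0(x),\iota_0(y)])$; this makes sense since $[\mathfrak g_0,\mathfrak g_0]\subseteq\mathfrak t$. *)

(* Defs.v *)
From HB Require Import structures.
From mathcomp Require Import all_boot all_order all_algebra.
From mathcomp Require Import all_fingroup all_solvable.

Set Implicit Arguments.
Unset Strict Implicit.
Unset Printing Implicit Defensive.

Import GRing.Theory.
Local Open Scope ring_scope.

HB.mixin Record Lmodule_isLieAlgebra (F : fieldType) L of GRing.Lmodule F L := {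
  lie : L -> L -> L;
  lie_linearl : forall y : L, linear (fun x : L => lie x y);
  lie_linearr : forall x : L, linear (lie x);
  liexx : forall x : L, lie x x = 0;
  lie_jacobi : forall x y z : L,
    lie x (lie y z) + lie y (lie z x) + lie z (lie x y) = 0
}.

#[short(type="lieAlgType")]
HB.structure Definition LieAlgebra (F : fieldType) :=
  {L of GRing.Lmodule F L & Lmodule_isLieAlgebra F L}.

Record lie_aut (F : fieldType) (g : lieAlgType F) := LieAut {
  lie_aut_fun :> {linear g -> g};
  lie_aut_bij : bijective lie_aut_fun;
  lie_aut_lie : {morph lie_aut_fun : x y / lie x y}
}.

(* Permutations are multiplied left to right in MathComp, i.e. [s * t] is
   "first [s], then [t]", so that [s * t] is the product written t s when
   permutations are composed right to left; whence the order in [a4M].  Only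
   the values on the alternating group are relevant. *)
Record A4_hom (F : fieldType) (g : lieAlgType F) := A4Hom {
  a4 :> {perm 'I_4} -> lie_aut g;
  a4M : {in Alt 'I_4 &, forall s t, a4 (s * t)%g =1 a4 t \o a4 s}
}.

(* The points 1, ..., 4 of the informal notation are the ordinals 0, ..., 3. *)
Notation p1 := (@Ordinal 4 0 isT).
Notation p2 := (@Ordinal 4 1 isT).
Notation p3 := (@Ordinal 4 2 isT).
Notation p4 := (@Ordinal 4 3 isT).

Definition tau1 : {perm 'I_4} := (tperm p1 p2 * tperm p3 p4)%g.
Definition tau2 : {perm 'I_4} := (tperm p2 p3 * tperm p1 p4)%g.
(* The cycle p1 -> p2 -> p3 -> p1, see [phiE]. *)
Definition phi : {perm 'I_4} := (tperm p1 p2 * tperm p1 p3)%g.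

Lemma phiE : [/\ phi p1 = p2, phi p2 = p3, phi p3 = p1 & phi p4 = p4].
Proof. by split; rewrite /phi !permE /= ?permE. Qed.

Lemma tau1_alt : tau1 \in Alt 'I_4.
Proof. by rewrite Alt_even odd_permM !odd_tperm. Qed.

Lemma tau2_alt : tau2 \in Alt 'I_4.
Proof. by rewrite Alt_even odd_permM !odd_tperm. Qed.

Lemma phi_alt : phi \in Alt 'I_4.
Proof. by rewrite Alt_even odd_permM !odd_tperm. Qed.

Lemma perm4P (s t : {perm 'I_4}) :
  [/\ s p1 = t p1, s p2 = t p2, s p3 = t p3 & s p4 = t p4] -> s = t.
Proof.
case=> e1 e2 e3 e4; apply/permP; case=> -[|[|[|[|//]]]] lt_i.
- by rewrite (_ : Ordinal lt_i = p1) //; apply: val_inj.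
- by rewrite (_ : Ordinal lt_i = p2) //; apply: val_inj.
- by rewrite (_ : Ordinal lt_i = p3) //; apply: val_inj.
- by rewrite (_ : Ordinal lt_i = p4) //; apply: val_inj.
Qed.

Lemma tau1_tau2 : (tau2 * tau1 = tau1 * tau2)%g.
Proof.
by apply: perm4P; split; do 8!rewrite ?permE /=.
Qed.

Lemma phi_tau1 : (tau1 * phi = phi * tau2)%g.
Proof.
by apply: perm4P; split; do 8!rewrite ?permE /=.
Qed.

Lemma phi_tau2 : (tau2 * phi = phi * (tau2 * tau1))%g.
Proof.
by apply: perm4P; split; do 8!rewrite ?permE /=.
Qed.

Section LieTheory.
Context (F : fieldType) (g : lieAlgType F).
Implicit Types x y z : g.

HB.instance Definition _ x := GRing.isLinear.Build F g g *:%R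
  (lie x) (lie_linearr x).

Definition lie_r y x := lie x y.
HB.instance Definition _ y := GRing.isLinear.Build F g g *:%R
  (lie_r y) (lie_linearl y).

Lemma lieNr x y : lie x (- y) = - lie x y.
Proof. exact: raddfN. Qed.

Lemma lieNl x y : lie (- x) y = - lie x y.
Proof. exact: (raddfN (lie_r y)). Qed.

End LieTheory.

Section Coordinate.
Context (F : fieldType) (g : lieAlgType F) (Phi : A4_hom g).
Implicit Types x y : g.

Definition tcomp : {pred g} :=
  [pred x | (Phi tau1 x == x) && (Phi tau2 x == x)].

Definition gcomp (i : 'Z_3) : {pred g} := [pred x |
  match val i with
  | 0%N => (Phi tau1 x == x) && (Phi tau2 x == - x)
  | 1%N => (Phi tau1 x == - x) && (Phi tau2 x == x)
  | _ => (Phi tau1 x == - x) && (Phi tau2 x == - x)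
  end].

Lemma tcomp_submod_closed : submod_closed tcomp.
Proof.
split=> [|a x y]; first by rewrite inE !raddf0 !eqxx.
rewrite !inE => /andP[/eqP x1 /eqP x2] /andP[/eqP y1 /eqP y2].
by rewrite !linearP x1 x2 y1 y2 !eqxx.
Qed.

Lemma gcomp0_submod_closed : submod_closed (gcomp 0).
Proof.
split=> [|a x y]; first by rewrite inE /= !raddf0 !eqxx.
rewrite !inE /= => /andP[/eqP x1 /eqP x2] /andP[/eqP y1 /eqP y2].
by rewrite !linearP x1 x2 y1 y2 !eqxx.
Qed.

HB.instance Definition _ :=
  GRing.isSubmodClosed.Build F g tcomp tcomp_submod_closed.
HB.instance Definition _ :=
  GRing.isSubmodClosed.Build F g (gcomp 0) gcomp0_submod_closed.

Record tsub := TSub { tval : g; _ : tval \in tcomp }.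
HB.instance Definition _ := [isSub for tval].
HB.instance Definition _ := [Choice of tsub by <:].
HB.instance Definition _ := [SubChoice_isSubLmodule of tsub by <:].

Record coordA := CoordA { Aval : g; _ : Aval \in gcomp 0 }.
HB.instance Definition _ := [isSub for Aval].
HB.instance Definition _ := [Choice of coordA by <:].
HB.instance Definition _ := [SubChoice_isSubLmodule of coordA by <:].

Definition iota_ (i : 'Z_3) (x : coordA) : g := iter i (Phi phi) (Aval x).

Lemma Phi1 x : Phi 1%g x = x.
Proof.
apply: (bij_inj (lie_aut_bij (Phi 1%g))).
by rewrite -[LHS](a4M Phi (group1 _) (group1 _)) mulg1.
Qed.

Lemma PhiM s t x : s \in Alt 'I_4 -> t \in Alt 'I_4 ->
  Phi t (Phi s x) = Phi (s * t)%g x.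
Proof. by move=> As At; rewrite (a4M Phi As At). Qed.

Lemma phiK : cancel (Phi phi) (Phi phi^-1%g).
Proof. by move=> x; rewrite PhiM ?groupV ?phi_alt // mulgV Phi1. Qed.

Lemma phiVK : cancel (Phi phi^-1%g) (Phi phi).
Proof. by move=> x; rewrite PhiM ?groupV ?phi_alt // mulVg Phi1. Qed.

Lemma tau2_phi x : Phi tau2 (Phi phi x) = Phi phi (Phi tau1 x).
Proof. by rewrite !PhiM ?phi_alt ?tau1_alt ?tau2_alt // phi_tau1. Qed.

Lemma tau1_phi x : Phi tau1 (Phi phi x) = Phi phi (Phi tau1 (Phi tau2 x)).
Proof.
rewrite !PhiM ?(groupM tau1_alt phi_alt) ?phi_alt ?tau1_alt ?tau2_alt //.
suff -> : (phi * tau1 = tau2 * (tau1 * phi))%g by [].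
by apply: perm4P; split; do 8!rewrite ?permE /=.
Qed.

Lemma phi_gcomp i x : x \in gcomp i -> Phi phi x \in gcomp (i + 1).
Proof.
case: i => -[|[|[|//]]] ?; rewrite !inE /= => /andP[/eqP x1 /eqP x2];
by rewrite tau1_phi tau2_phi x2 ?raddfN /= x1 ?raddfN /= ?opprK !eqxx.
Qed.

Lemma phiV_gcomp i x : x \in gcomp (i + 1) -> Phi phi^-1%g x \in gcomp i.
Proof.
move=> xi; have := phi_gcomp xi => /phi_gcomp.
have -> : i + 1 + 1 + 1 = i.
  by rewrite -!addrA; apply: val_inj; case: i {xi} => -[|[|[|//]]].
rewrite !PhiM ?(groupM phi_alt phi_alt) ?phi_alt //.
suff -> : (phi * phi = phi^-1)%g by [].
apply: (mulgI phi); rewrite mulgV.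
by apply: perm4P; split; do 8!rewrite ?permE /=.
Qed.

Lemma iota_gcomp i (x : coordA) : iota_ i x \in gcomp i.
Proof.
have x0 : Aval x \in gcomp 0 by case: x.
suff: forall n, iter n (Phi phi) (Aval x) \in gcomp n%:R.
  by move=> /(_ i); rewrite natr_Zp.
by elim=> [|n IHn] //=; rewrite mulrS addrC phi_gcomp.
Qed.

Lemma lie_tcomp_gcomp i d x : d \in tcomp -> x \in gcomp i ->
  lie d x \in gcomp i.
Proof.
case: i => -[|[|[|//]]] ?; rewrite !inE /= => /andP[/eqP d1 /eqP d2]
  /andP[/eqP x1 /eqP x2];
by rewrite !lie_aut_lie d1 d2 x1 x2 !lieNr !eqxx.
Qed.

Lemma lie_gcomp_tcomp i x y : x \in gcomp i -> y \in gcomp i ->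
  lie x y \in tcomp.
Proof.
case: i => -[|[|[|//]]] ?; rewrite !inE /= => /andP[/eqP x1 /eqP x2]
  /andP[/eqP y1 /eqP y2];
by rewrite !lie_aut_lie x1 x2 y1 y2 ?lieNr ?lieNl ?opprK !eqxx.
Qed.

Lemma lie_gcomp12 x y : x \in gcomp 1 -> y \in gcomp 2%:R ->
  lie x y \in gcomp 0.
Proof.
rewrite !inE /= => /andP[/eqP x1 /eqP x2] /andP[/eqP y1 /eqP y2].
by rewrite !lie_aut_lie x1 x2 y1 y2 ?lieNr ?lieNl ?opprK !eqxx.
Qed.

Definition star (x y : coordA) : coordA :=
  CoordA (lie_gcomp12 (iota_gcomp 1 x) (iota_gcomp 2%:R y)).

Lemma starE (x y : coordA) : lie (iota_ 1 x) (iota_ 2%:R y) = iota_ 0 (star x y).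
Proof. by []. Qed.

Lemma iter_phiV_gcomp (i : 'Z_3) x :
  x \in gcomp i -> iter i (Phi phi^-1%g) x \in gcomp 0.
Proof.
rewrite -{1}[i]natr_Zp; elim: (nat_of_ord i) x => [|n IHn] x //.
by rewrite iterSr mulrS addrC => /phiV_gcomp; apply: IHn.
Qed.

Lemma rho_subproof (i : 'Z_3) (d : tsub) (x : coordA) :
  iter i (Phi phi^-1%g) (lie (tval d) (iota_ i x)) \in gcomp 0.
Proof.
by apply/iter_phiV_gcomp/lie_tcomp_gcomp/iota_gcomp; case: d.
Qed.

(* This is the inverse image of [d, iota_i(x)] under iota_i, see [rhoE]. *)
Definition rho_fun (i : 'Z_3) (d : tsub) (x : coordA) : coordA :=
  CoordA (rho_subproof i d x).

Lemma rhoE i d (x : coordA) : iota_ i (rho_fun i d x) = lie (tval d) (iota_ i x).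
Proof.
rewrite {1}/iota_ /=; elim: (nat_of_ord i) (lie _ _) => //= n IHn y.
by rewrite -iterS iterSr phiVK IHn.
Qed.

Lemma iterPhi_linear s n : linear (iter n (Phi s)).
Proof. by move=> a x y; elim: n => //= n ->; rewrite linearP. Qed.

Lemma star_linearr (x : coordA) : linear (star x).
Proof.
move=> a y z; apply: val_inj; rewrite /= /iota_.
by rewrite iterPhi_linear lie_linearr.
Qed.

Lemma star_linearl (y : coordA) : linear (star^~ y).
Proof.
move=> a x z; apply: val_inj; rewrite /= /iota_.
by rewrite iterPhi_linear lie_linearl.
Qed.

Definition lmul_fun (x z : coordA) : coordA := star x z.
HB.instance Definition _ (x : coordA) := GRing.isLinear.Build F coordA coordA *:%R
  (lmul_fun x) (star_linearr x).
Definition lmul (x : coordA) : {linear coordA -> coordA} := lmul_fun x.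

Definition rmul_fun (x z : coordA) : coordA := star z x.
HB.instance Definition _ (x : coordA) := GRing.isLinear.Build F coordA coordA *:%R
  (rmul_fun x) (star_linearl x).
Definition rmul (x : coordA) : {linear coordA -> coordA} := rmul_fun x.

Lemma rho_linear i d : linear (rho_fun i d).
Proof.
move=> a x y; apply: val_inj; rewrite /= /iota_ /=.
by rewrite iterPhi_linear lie_linearr iterPhi_linear.
Qed.

HB.instance Definition _ i d := GRing.isLinear.Build F coordA coordA *:%R
  (rho_fun i d) (rho_linear i d).

Definition rho (i : 'Z_3) (d : tsub) : {linear coordA -> coordA} :=
  rho_fun i d.

Definition lieA (x y : coordA) : tsub :=
  TSub (lie_gcomp_tcomp (iota_gcomp 0 x) (iota_gcomp 0 y)).

Definition delta (i : 'Z_3) (x y : coordA) : {linear coordA -> coordA} :=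
  rho i (lieA x y).

Definition gl_lie (f h : {linear coordA -> coordA}) :
  {linear coordA -> coordA} := (f \o h) \- (h \o f).

End Coordinate.

(* Main.v *)
(** Since [phi ^ 3 = 1], the automorphism induced by [phi] shifts the index of every [iota_ i],
    so the action of [delta i x y] can be read off in any component [j], namely as
    the action of [lie (iota_ (j - i) x) (iota_ (j - i) y)] on [iota_ j z].  Each
    identity, read in a suitable component, is then an instance of the Jacobi
    identity. *)
Require Import Defs.
From HB Require Import structures.
From mathcomp Require Import all_boot all_order all_algebra.
From mathcomp Require Import all_fingroup all_solvable.
Import GRing.Theory.
Local Open Scope ring_scope.

Section LieIdentities.
Context (F : fieldType) (g : lieAlgType F).
Implicit Types x y z : g.

Lemma lieDr x y z : lie x (y + z) = lie x y + lie x z.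
Proof. exact: raddfD. Qed.

Lemma lieDl x y z : lie (x + y) z = lie x z + lie y z.
Proof. exact: (raddfD (lie_r z)). Qed.

Lemma lie0l x : lie 0 x = 0.
Proof. exact: (raddf0 (lie_r x)). Qed.

Lemma lieC x y : lie x y = - lie y x.
Proof.
apply/eqP; rewrite -addr_eq0; apply/eqP.
by have := liexx (x + y); rewrite lieDl !lieDr !liexx add0r addr0.
Qed.

(** Jacobi in the form that [ad] is a Lie homomorphism; [lie_lier] is the form that [ad x] is a
    derivation. *)
Lemma lie_liel x y z : lie (lie x y) z = lie x (lie y z) - lie y (lie x z).
Proof.
rewrite (lieC (lie x y) z) (lieC x z) lieNr opprK.
by apply/esym/eqP; rewrite -addr_eq0 lie_jacobi.
Qed.

Lemma lie_lier x y z : lie x (lie y z) = lie (lie x y) z + lie y (lie x z).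
Proof. by rewrite lie_liel subrK. Qed.

End LieIdentities.

Section Coordinate.
Context (F : fieldType) (g : lieAlgType F) (Phi : A4_hom g).
Implicit Types (x y z : coordA Phi) (i j k : 'Z_3).

Lemma phi3 (v : g) : Phi phi (Phi phi (Phi phi v)) = v.
Proof.
suff e : (phi * (phi * phi) = 1)%g.
  by rewrite !PhiM ?(groupM phi_alt phi_alt) ?phi_alt // e Phi1.
by apply: perm4P; split; do 8!rewrite ?permE /=.
Qed.

(** Only at [i = 2], where the index wraps around to 0, is [phi3] needed. *)
Lemma iotaS i x : iota_ (i + 1) x = Phi phi (iota_ i x).
Proof. by case: i => -[|[|[|//]]] ? //=; rewrite /iota_ /= phi3. Qed.

Lemma Z3_ind (P : 'Z_3 -> Prop) :
  P 0 -> (forall k, P k -> P (k + 1)) -> forall k, P k.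
Proof.
move=> P0 PS k; rewrite -[k]natr_Zp; elim: (nat_of_ord k) => // n IHn.
by rewrite mulrS addrC; apply: PS.
Qed.

Lemma iota_inj i : injective (@iota_ F g Phi i).
Proof.
move=> x y; elim/Z3_ind: i => [|i IHi]; first exact: val_inj.
by rewrite !iotaS => /(can_inj (phiK Phi)).
Qed.

Lemma iota_linear i : linear (@iota_ F g Phi i).
Proof. by move=> a x y; apply: iterPhi_linear. Qed.

HB.instance Definition _ i := GRing.isLinear.Build F (coordA Phi) g *:%R
  (@iota_ F g Phi i) (iota_linear i).

Lemma iota_star i x y :
  lie (iota_ (i + 1) x) (iota_ (i + 2%:R) y) = iota_ i (star x y).
Proof.
(* Index 0 is the definition of [star]; applying [Phi phi] raises all three indices by one. *)
elim/Z3_ind: i => [|i IHi]; first by rewrite !add0r starE.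
rewrite (addrAC i 1 2%:R) (iotaS (i + 1)) (iotaS (i + 2%:R)).
by rewrite -lie_aut_lie IHi iotaS.
Qed.

Lemma iota_delta i j x y z :
  iota_ j (delta i x y z) =
  lie (lie (iota_ (j - i) x) (iota_ (j - i) y)) (iota_ j z).
Proof.
(* Induction on the gap [k = j - i], with [i] fixed; a zero gap is the definition of [rho]. *)
rewrite -[j in iota_ j](subrK i) addrC; elim/Z3_ind: (j - i) => [|k IHk].
  by rewrite addr0 rhoE.
by rewrite addrA !iotaS IHk !lie_aut_lie.
Qed.

Lemma gl_lie_delta i j a b x y :
  gl_lie (delta i a b) (delta j x y) =1
    delta j (delta (i - j) a b x) y \+ delta j x (delta (i - j) a b y).
Proof.
move=> z; apply: (@iota_inj j).
(* With [D] the bracket of [iota_ (j - i) a] and [iota_ (j - i) b], both [delta i a b] on component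
   [j] and [delta (i - j) a b] on component 0 are [ad D], a derivation. *)
rewrite /= raddfB raddfD /= !iota_delta subrr sub0r opprB -lieDl -lie_lier.
by rewrite -lie_liel.
Qed.

Lemma delta_star_cyclic x y z :
  delta 0 x (star y z) \+ delta (- 1) y (star z x)
    \+ delta (- 2%:R) z (star x y) =1 (fun=> 0).
Proof.
move=> t; apply: (@iota_inj 0).
rewrite /= !raddfD raddf0 /= !iota_delta subr0 !sub0r !opprK -!lieDl.
(* The three acting elements are the Jacobi terms of [iota_ 0 x], [iota_ 1 y], [iota_ 2 z]. *)
by rewrite -!iota_star lie_jacobi lie0l.
Qed.

Lemma delta0_cyclic x y z :
  delta 0 x y z + delta 0 y z x + delta 0 z x y = 0.
Proof.
apply: (@iota_inj 0); rewrite !raddfD raddf0 /= !iota_delta subrr.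
by rewrite !(lieC _ _ (lie _ _)) -!opprD lie_jacobi oppr0.
Qed.

Lemma delta1E x y : delta 1 x y =1 (rmul y \o lmul x) \- (rmul x \o lmul y).
Proof.
move=> z; apply: (@iota_inj 1); rewrite raddfB /= iota_delta subrr lie_liel.
have step u v : lie (iota_ 0 u) (lie (iota_ 0 v) (iota_ 1 z)) =
    - iota_ 1 (rmul u (lmul v z)).
  (* The inner bracket lands in index 2, the outer one back in index 1; only the outer is out of
     cyclic order, whence the sign. *)
  by rewrite lieC (iota_star 2%:R) (iota_star 1).
by rewrite !step opprK addrC.
Qed.

Lemma delta2E x y : delta 2%:R x y =1 (lmul y \o rmul x) \- (lmul x \o rmul y).
Proof.
move=> z; apply: (@iota_inj 2%:R); rewrite raddfB /= iota_delta subrr lie_liel.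
have step u v : lie (iota_ 0 u) (lie (iota_ 0 v) (iota_ 2%:R z)) =
    - iota_ 2%:R (lmul u (rmul v z)).
  (* Here it is the inner bracket, of indices 0 and 2, that is out of cyclic order. *)
  by rewrite (lieC _ _ (iota_ 0 v)) lieNr (iota_star 1) (iota_star 2%:R).
by rewrite !step opprK addrC.
Qed.

End Coordinate.

Theorem theorem1p9 (F : fieldType) (charF : 2%N \notin [pchar F])
    (g : lieAlgType F) (Phi : A4_hom g)
    (a b x y z : coordA Phi) (i j : 'Z_3) :
  [/\ gl_lie (delta i a b) (delta j x y) =1
        delta j (delta (i - j) a b x) y \+ delta j x (delta (i - j) a b y),
      delta 0 x (star y z) \+ delta (- 1) y (star z x)
        \+ delta (- 2%:R) z (star x y) =1 (fun=> 0),
      delta 0 x y z + delta 0 y z x + delta 0 z x y = 0,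
      delta 1 x y =1 (rmul y \o lmul x) \- (rmul x \o lmul y)
    & delta 2%:R x y =1 (lmul y \o rmul x) \- (lmul x \o rmul y)].
Proof.
split; [exact: gl_lie_delta | exact: delta_star_cyclic
  | exact: delta0_cyclic | exact: delta1E | exact: delta2E].
Qed.
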